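(* Let $(H,[-,-,-])$ be a Hopf heap and $x\in G(H)$. Define a multiplication on $H$ by $$a\cdot_x b=\varepsilon(a)\varepsilon(b)x,\qquad a,b\in H.$$ Then $(H,\cdot_x,[-,-,-])$ is a Hopf truss.
   Context: Everything is over a fixed field $\mathbf{k}$. Sweedler notation $\Delta(c)=c_1\otimes c_2$ is used; $C^{cop}$ is the co-opposite coalgebra; $G(C)$ is the set of group-like elements of a coalgebra $C$. A Hopf heap is a coalgebra $C$ with a coalgebra map $C\otimes C^{cop}\otimes C\to C$, $a\otimes b\otimes c\mapsto[a,b,c]$, such that $[[a,b,c],d,h]=[a,b,[c,d,h]]$ and $[c_1,c_2,a]=[a,c_1,c_2]=\varepsilon(c)a$ for all $a,b,c,d,h\in C$. A Hopf truss is a Hopf heap $(H,[-,-,-])$ together with a multiplication $\circ$ making the same coalgebra a nonunital bialgebra $(H,\circ,\Delta,\varepsilon)$ (associative multiplication which is a coalgebra map, unit not required) such that $a\circ[b,c,d]=[a_1\circ b,a_2\circ c,a_3\circ d]$ for all $a,b,c,d\in H$. *)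

(* Defs.v *)
From HB Require Import structures.
From mathcomp Require Import all_boot all_algebra.
From mathcomp Require Import finmap boolp monalg.

Set Implicit Arguments.
Unset Strict Implicit.
Unset Printing Implicit Defensive.
Import GRing.Theory Quotient.
Local Open Scope ring_scope.
Local Open Scope quotient_scope.

Reserved Notation "x ⊗ y" (at level 40, left associativity).

Definition is_bilinear (k : fieldType) (U V W : lmodType k)
    (f : U -> V -> W) : Prop :=
  (forall v, linear (f^~ v)) /\ (forall u, linear (f u)).

Section TensorNull.
Variables (k : fieldType) (U V : lmodType k).
Local Notation free := {malg k[(U * V)%type]}.

(* The submodule generated by the bilinearity relations; U ⊗ V is the free module
   on U * V modulo tensor_null. *)
Inductive tensor_null : free -> Prop :=
| TensorNull0 : tensor_null 0
| TensorNullL a b u u' v g : tensor_null g ->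
    tensor_null
      (b *: (<< (a *: u + u', v) >> - a *: << (u, v) >> - << (u', v) >>) + g)
| TensorNullR a b u v v' g : tensor_null g ->
    tensor_null
      (b *: (<< (u, a *: v + v') >> - a *: << (u, v) >> - << (u, v') >>) + g).

Lemma tensor_null_add g h : tensor_null g -> tensor_null h -> tensor_null (g + h).
Proof.
move=> ng nh; elim: ng => [|a b u u' v {}g _ IH|a b u v v' {}g _ IH].
- by rewrite add0r.
- by rewrite -addrA; apply: TensorNullL.
- by rewrite -addrA; apply: TensorNullR.
Qed.

Lemma tensor_null_scale c g : tensor_null g -> tensor_null (c *: g).
Proof.
elim=> [|a b u u' v {}g _ IH|a b u v v' {}g _ IH].
- by rewrite scaler0; apply: TensorNull0.
- by rewrite scalerDr scalerA; apply: TensorNullL.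
- by rewrite scalerDr scalerA; apply: TensorNullR.
Qed.

Definition tensor_nullb : {pred free} := fun g => `[< tensor_null g >].

Lemma tensor_nullb_closed : zmod_closed tensor_nullb.
Proof.
split=> [|g h /asboolP ng /asboolP nh]; apply/asboolP; first exact: TensorNull0.
by rewrite -scaleN1r; apply/tensor_null_add/tensor_null_scale.
Qed.

HB.instance Definition _ :=
  GRing.isZmodClosed.Build free tensor_nullb tensor_nullb_closed.

Let tquot : Type := {quot tensor_nullb}.
HB.instance Definition _ := GRing.Zmodule.on tquot.

Let pr (g : free) : tquot := \pi_({quot tensor_nullb}) g.
Let rp (t : tquot) : free := repr (t : {quot tensor_nullb}).

Let rpK : cancel rp pr. Proof. exact: reprK. Qed.

Let prP g h : pr g = pr h <-> tensor_null (g - h).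
Proof.
split=> [/eqP|ngh]; last apply/eqP; rewrite -[_ == _]idealrBE.
  by move/asboolP.
exact/asboolP.
Qed.

Let prD g h : pr (g + h) = pr g + pr h.
Proof. exact: (pi_add tensor_nullb). Qed.

Let scale (a : k) (t : tquot) : tquot := pr (a *: rp t).

Let prZ a g : pr (a *: g) = scale a (pr g).
Proof.
apply/prP; rewrite -scalerBr; apply: tensor_null_scale.
by apply/prP; rewrite rpK.
Qed.

Fact tquot_scaleA a b t : scale a (scale b t) = scale (a * b) t.
Proof. by rewrite -[t]rpK -!prZ scalerA. Qed.
Fact tquot_scale1 : left_id 1 scale.
Proof. by move=> t; rewrite -[t]rpK -prZ scale1r. Qed.
Fact tquot_scaleDr : right_distributive scale +%R.
Proof. by move=> a s t; rewrite -[s]rpK -[t]rpK -!(prD, prZ) scalerDr. Qed.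
Fact tquot_scaleDl t : {morph scale^~ t : a b / a + b}.
Proof. by move=> a b; rewrite -[t]rpK -!(prD, prZ) scalerDl. Qed.

HB.instance Definition _ := GRing.Zmodule_isLmodule.Build k tquot
  tquot_scaleA tquot_scale1 tquot_scaleDr tquot_scaleDl.

Fact tquot_proj_linear : linear pr.
Proof. by move=> a g h; rewrite prD prZ. Qed.

(* The quotient by tensor_null is packaged with its projection and locked, so
   that unification never unfolds the module structure. *)
Record tensor_quotient := TensorQuotient {
  tq_sort : lmodType k;
  tq_proj : free -> tq_sort;
  tq_repr : tq_sort -> free;
  tq_proj_linear : linear tq_proj;
  tq_reprK : cancel tq_repr tq_proj;
  tq_projP : forall g h, tq_proj g = tq_proj h <-> tensor_null (g - h)
}.

Fact tensor_key : unit. Proof. exact: tt. Qed.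
Definition tensor_quot : tensor_quotient := locked_with tensor_key
  (@TensorQuotient tquot pr rp tquot_proj_linear rpK prP).

Definition tensor : Type := tq_sort tensor_quot.
HB.instance Definition _ := GRing.Lmodule.on tensor.

Definition tproj (g : free) : tensor := tq_proj tensor_quot g.
Definition trepr (t : tensor) : free := @tq_repr tensor_quot t.

Lemma tproj_linear : linear tproj. Proof. exact: tq_proj_linear. Qed.
HB.instance Definition _ :=
  GRing.isLinear.Build k free tensor _ tproj tproj_linear.

Lemma treprK t : tproj (trepr t) = t. Proof. exact: tq_reprK. Qed.

Lemma tprojP g h : tproj g = tproj h <-> tensor_null (g - h).
Proof. exact: tq_projP. Qed.

Definition tens (u : U) (v : V) : tensor := tproj << (u, v) >>.

End TensorNull.

Arguments tensor k U%_type V%_type.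
Notation "U ⊗ V" := (tensor U V) : type_scope.
Notation "u ⊗ v" := (tens u v) : ring_scope.

Section TensorLift.
Variables (k : fieldType) (U V W : lmodType k).
Implicit Types (f : U -> V -> W) (g h : {malg k[(U * V)%type]}).

Definition free_lift f g : W := \sum_(p <- msupp g) g@_p *: f p.1 p.2.

(* The map u ⊗ v |-> f u v. It is defined for every f, so that no bilinearity
   proof has to be carried around, but is meaningful only for bilinear f
   (lemmas tlift_linear and tliftE). *)
Definition tlift f (t : U ⊗ V) : W := free_lift f (trepr t).

Lemma free_liftEw f g (d : {fset (U * V)%type}) :
  (msupp g `<=` d)%fset -> free_lift f g = \sum_(p <- d) g@_p *: f p.1 p.2.
Proof.
move=> sub; rewrite /free_lift (big_fset_incl _ sub) // => p _ pn.
by rewrite mcoeff_outdom // scale0r.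
Qed.

Lemma free_lift_linear f : linear (free_lift f).
Proof.
move=> a g h.
pose d := (msupp g `|` msupp h)%fset.
have sg : (msupp g `<=` d)%fset by apply: fsubsetUl.
have sh : (msupp h `<=` d)%fset by apply: fsubsetUr.
have sgh : (msupp (a *: g + h) `<=` d)%fset.
  apply: fsubset_trans (msuppD_le _ _) _; rewrite fsubUset sh andbT.
  exact: fsubset_trans (msuppZ_le _ _) sg.
rewrite !(@free_liftEw f _ d) // scaler_sumr -big_split /=.
by apply: eq_bigr => p _; rewrite mcoeffD mcoeffZ scalerDl scalerA.
Qed.

Lemma free_liftU f u v : free_lift f << (u, v) >> = f u v.
Proof.
by rewrite /free_lift msuppU oner_eq0 big_seq_fset1 mcoeffUU scale1r.
Qed.

HB.instance Definition _ f := GRing.isLinear.Build k _ W _ (free_lift f)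
  (free_lift_linear f).

Variables (f : U -> V -> W) (fbil : is_bilinear f).

Lemma free_lift_null g : tensor_null g -> free_lift f g = 0.
Proof.
case: fbil => fl fr.
have lin a p q r : free_lift f p = a *: free_lift f q + free_lift f r ->
    free_lift f (p - a *: q - r) = 0.
  move=> e; rewrite linearB /= linearB /= linearZ_LR /= e.
  by rewrite -addrA -opprD subrr.
elim=> [|a b u u' v {}g _ IH|a b u v v' {}g _ IH]; first exact: raddf0.
  by rewrite linearP /= IH addr0 lin ?scaler0 // !free_liftU fl.
by rewrite linearP /= IH addr0 lin ?scaler0 // !free_liftU fr.
Qed.

Lemma tlift_proj g : tlift f (tproj g) = free_lift f g.
Proof.
apply/eqP; rewrite -subr_eq0 -linearB; apply/eqP/free_lift_null/tprojP.
exact: treprK.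
Qed.

Lemma tliftE u v : tlift f (u ⊗ v) = f u v.
Proof. by rewrite tlift_proj free_liftU. Qed.

Lemma tlift_linear : linear (tlift f).
Proof.
move=> a s t; rewrite -[s]treprK -[t]treprK -linearP !tlift_proj.
exact: linearP.
Qed.

End TensorLift.

Section TensorTheory.
Variables (k : fieldType) (U V : lmodType k).

Lemma tens_bilinear : is_bilinear (@tens k U V).
Proof.
split=> [v a u u'|u a v v']; rewrite /tens -linearP;
  apply/tprojP; rewrite opprD addrA -[X in tensor_null X]scale1r -[X in tensor_null X]addr0.
- exact/TensorNullL/TensorNull0.
- exact/TensorNullR/TensorNull0.
Qed.

Lemma tens_sum (t : U ⊗ V) :
  t = \sum_(p <- msupp (trepr t)) (trepr t)@_p *: (p.1 ⊗ p.2).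
Proof.
rewrite -[LHS]treprK [X in tproj X]monalgE linear_sum /=.
apply: eq_bigr => p _; rewrite /tens -linearZ_LR -surjective_pairing /=.
congr tproj; by apply/malgP => q; rewrite mcoeffZ !mcoeffU mulrnAr mulr1.
Qed.

Lemma tensor_ext (W : lmodType k) (f g : U ⊗ V -> W) :
  linear f -> linear g -> (forall u v, f (u ⊗ v) = g (u ⊗ v)) -> f =1 g.
Proof.
move=> fl gl fg t.
pose F : {linear (U ⊗ V)%type -> W} := HB.pack f (GRing.isLinear.Build k _ _ _ f fl).
pose G : {linear (U ⊗ V)%type -> W} := HB.pack g (GRing.isLinear.Build k _ _ _ g gl).
rewrite -[f t]/(F t) -[g t]/(G t) [t]tens_sum !linear_sum.
by apply: eq_bigr => p _; rewrite !linearZ_LR; congr (_ *: _); apply: fg.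
Qed.

End TensorTheory.

Lemma tlift_linear_param (k : fieldType) (U V W X : lmodType k)
    (F : X -> U -> V -> W) (t : U ⊗ V) :
  (forall u v, linear (fun x => F x u v)) -> linear (fun x => tlift (F x) t).
Proof.
move=> Fl a x y; rewrite /tlift /free_lift scaler_sumr -big_split /=.
by apply: eq_bigr => p _; rewrite Fl scalerDr !scalerA mulrC.
Qed.

Section TensorMaps.
Variable k : fieldType.
Implicit Types U V W X : lmodType k.

Definition tmap U V W X (f : U -> W) (g : V -> X) : U ⊗ V -> W ⊗ X :=
  tlift (fun u v => f u ⊗ g v).

Definition tswap U V : U ⊗ V -> V ⊗ U := tlift (fun u v => v ⊗ u).

Definition tassoc U V W : (U ⊗ V) ⊗ W -> U ⊗ (V ⊗ W) :=
  tlift (fun t w => tlift (fun u v => u ⊗ (v ⊗ w)) t).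

(* (u ⊗ v) ⊗ (w ⊗ x) |-> (u ⊗ w) ⊗ (v ⊗ x) *)
Definition tinter U V W X : (U ⊗ V) ⊗ (W ⊗ X) -> (U ⊗ W) ⊗ (V ⊗ X) :=
  tlift (fun s t => tlift (fun u v => tlift (fun w x => (u ⊗ w) ⊗ (v ⊗ x)) t) s).

Lemma tensl_linear U V (v : V) : linear (fun u : U => u ⊗ v).
Proof. exact: (tens_bilinear U V).1. Qed.
Lemma tensr_linear U V (u : U) : linear (fun v : V => u ⊗ v).
Proof. exact: (tens_bilinear U V).2. Qed.

Lemma tensZl U V a (u : U) (v : V) : (a *: u) ⊗ v = a *: (u ⊗ v).
Proof. exact: (scalable_linear (tensl_linear v)). Qed.
Lemma tensZr U V a (u : U) (v : V) : u ⊗ (a *: v) = a *: (u ⊗ v).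
Proof. exact: (scalable_linear (tensr_linear u)). Qed.

Lemma linear_comp U V W (f : V -> W) (g : U -> V) :
  linear f -> linear g -> linear (fun x => f (g x)).
Proof. by move=> fl gl a x y; rewrite gl fl. Qed.

Lemma tmap_bilinear U V W X (f : U -> W) (g : V -> X) :
  linear f -> linear g -> is_bilinear (fun u v => f u ⊗ g v).
Proof.
by move=> fl gl; split=> [v|u] a x y; rewrite ?fl ?gl (tensl_linear, tensr_linear).
Qed.

Lemma tmapE U V W X (f : U -> W) (g : V -> X) u v :
  linear f -> linear g -> tmap f g (u ⊗ v) = f u ⊗ g v.
Proof. by move=> fl gl; rewrite /tmap tliftE //; apply: tmap_bilinear. Qed.

Lemma tmap_linear U V W X (f : U -> W) (g : V -> X) :
  linear f -> linear g -> linear (tmap f g).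
Proof. by move=> fl gl; apply/tlift_linear/tmap_bilinear. Qed.

Lemma tswap_bilinear U V : is_bilinear (fun (u : U) (v : V) => v ⊗ u).
Proof. by split=> [v|u]; [apply: tensr_linear|apply: tensl_linear]. Qed.

Lemma tswap_linear U V : linear (@tswap U V).
Proof. exact/tlift_linear/tswap_bilinear. Qed.
HB.instance Definition _ U V :=
  GRing.isLinear.Build k _ _ _ (@tswap U V) (@tswap_linear U V).

Lemma tswapE U V (u : U) (v : V) : tswap (u ⊗ v) = v ⊗ u.
Proof. by rewrite /tswap tliftE //; apply: tswap_bilinear. Qed.

Lemma tassoc_bilinear1 U V W (w : W) :
  is_bilinear (fun (u : U) (v : V) => u ⊗ (v ⊗ w)).
Proof.
split=> [v|u]; first exact: tensl_linear.
by move=> a v v'; rewrite tensl_linear tensr_linear.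
Qed.

Lemma tassoc_bilinear U V W :
  is_bilinear (fun (t : U ⊗ V) (w : W) => tlift (fun u v => u ⊗ (v ⊗ w)) t).
Proof.
split=> [w|t]; first exact/tlift_linear/tassoc_bilinear1.
apply: tlift_linear_param => u v a w w'.
by rewrite tensr_linear tensr_linear.
Qed.

Lemma tassoc_linear U V W : linear (@tassoc U V W).
Proof. exact/tlift_linear/tassoc_bilinear. Qed.
HB.instance Definition _ U V W :=
  GRing.isLinear.Build k _ _ _ (@tassoc U V W) (@tassoc_linear U V W).

Lemma tassocE U V W (u : U) (v : V) (w : W) :
  tassoc (u ⊗ v ⊗ w) = u ⊗ (v ⊗ w).
Proof.
rewrite /tassoc tliftE; last exact: tassoc_bilinear.
by rewrite tliftE //; apply: tassoc_bilinear1.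
Qed.

Lemma tinter_bilinear2 U V W X (u : U) (v : V) :
  is_bilinear (fun (w : W) (x : X) => (u ⊗ w) ⊗ (v ⊗ x)).
Proof. by apply: tmap_bilinear; apply: tensr_linear. Qed.

Lemma tinter_bilinear1 U V W X (t : W ⊗ X) :
  is_bilinear (fun (u : U) (v : V) =>
    tlift (fun (w : W) (x : X) => (u ⊗ w) ⊗ (v ⊗ x)) t).
Proof.
split=> [v|u]; apply: tlift_linear_param => w x a y z; rewrite tensl_linear.
  exact: tensl_linear.
exact: tensr_linear.
Qed.

Lemma tinter_bilinear U V W X : is_bilinear (fun (s : U ⊗ V) (t : W ⊗ X) =>
  tlift (fun u v => tlift (fun w x => (u ⊗ w) ⊗ (v ⊗ x)) t) s).
Proof.
split=> [t|s]; first exact/tlift_linear/tinter_bilinear1.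
by apply: tlift_linear_param => u v; apply/tlift_linear/tinter_bilinear2.
Qed.

Lemma tinter_linear U V W X : linear (@tinter U V W X).
Proof. exact/tlift_linear/tinter_bilinear. Qed.
HB.instance Definition _ U V W X :=
  GRing.isLinear.Build k _ _ _ (@tinter U V W X) (@tinter_linear U V W X).

Lemma tinterE U V W X (u : U) (v : V) (w : W) (x : X) :
  tinter ((u ⊗ v) ⊗ (w ⊗ x)) = (u ⊗ w) ⊗ (v ⊗ x).
Proof.
rewrite /tinter tliftE; last exact: tinter_bilinear.
rewrite tliftE; last exact: tinter_bilinear1.
by rewrite tliftE //; apply: tinter_bilinear2.
Qed.

End TensorMaps.

Arguments tswap {k U V} t.
Arguments tassoc {k U V W} t.
Arguments tinter {k U V W X} t.

HB.instance Definition _ (k : fieldType) (U V W X : lmodType k)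
    (f : {linear U -> W}) (g : {linear V -> X}) :=
  GRing.isLinear.Build k _ _ _ (tmap f g)
    (@tmap_linear _ _ _ _ _ f g (fun a => @linearP _ _ _ _ f a)
       (fun a => @linearP _ _ _ _ g a)).

Lemma tmapP (k : fieldType) (U V W X : lmodType k)
    (f : {linear U -> W}) (g : {linear V -> X}) : linear (tmap f g).
Proof. exact: linearP. Qed.

HB.mixin Record isCoalgebra (k : fieldType) C of GRing.Lmodule k C := {
  delta : {linear C -> (C ⊗ C)%type};
  counit : {scalar C};
  delta_coassoc : forall c : C,
    tassoc (tmap delta idfun (delta c)) = tmap idfun delta (delta c);
  delta_counitl : forall c : C, tlift (fun c1 c2 => counit c1 *: c2) (delta c) = c;
  delta_counitr : forall c : C, tlift (fun c1 c2 => counit c2 *: c1) (delta c) = c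
}.

#[short(type="coalgType")]
HB.structure Definition Coalgebra (k : fieldType) :=
  {C of isCoalgebra k C & GRing.Lmodule k C}.

Lemma delta_linear (k : fieldType) (C : coalgType k) : linear (@delta k C).
Proof. exact: linearP. Qed.

Lemma counit_linear (k : fieldType) (C : coalgType k) : scalar (@counit k C).
Proof. exact: linearP. Qed.

Ltac lin_rew := rewrite ?(delta_linear, tmapP, tswap_linear, tassoc_linear,
  tinter_linear, tensl_linear, tensr_linear).
Ltac lin := let a := fresh in let x := fresh in let y := fresh in
  move=> a x y; lin_rew; done.

Definition coalgebra_map (k : fieldType) (C D : coalgType k)
    (f : C -> D) : Prop :=
  [/\ linear f,
      forall c, delta (f c) = tmap f f (delta c)
    & forall c, counit (f c) = counit c].

Definition group_like (k : fieldType) (C : coalgType k) (x : C) : Prop :=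
  delta x = x ⊗ x /\ counit x = 1.

Section Sweedler.
Variables (k : fieldType) (C : coalgType k) (W : lmodType k).

(* [sweedler2 f c] is f c_1 c_2 and [sweedler3 f c] is f c_1 c_2 c_3, the latter
   computed from (Δ ⊗ id) Δ; f has to be multilinear. *)
Definition sweedler2 (f : C -> C -> W) (c : C) : W := tlift f (delta c).
Definition sweedler3 (f : C -> C -> C -> W) (c : C) : W :=
  sweedler2 (fun c' c3 => sweedler2 (fun c1 c2 => f c1 c2 c3) c') c.

End Sweedler.

Section CounitScale.
Variables (k : fieldType) (C : coalgType k).

Lemma scale_bilinearl : is_bilinear (fun c1 c2 : C => counit c1 *: c2).
Proof.
split=> [v|u] a x y; first by rewrite counit_linear scalerDl scalerA.
by rewrite scalerDr !scalerA mulrC.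
Qed.
Lemma scale_bilinearr : is_bilinear (fun c1 c2 : C => counit c2 *: c1).
Proof.
split=> [v|u] a x y; last by rewrite counit_linear scalerDl scalerA.
by rewrite scalerDr !scalerA mulrC.
Qed.

End CounitScale.

(* The co-opposite coalgebra lives on an alias of C, so a : C can be used as
   (a : cop C). *)
Definition cop (k : fieldType) (C : coalgType k) : Type := C.

Section Coopposite.
Variables (k : fieldType) (C : coalgType k).

HB.instance Definition _ := GRing.Lmodule.on (cop C).

Definition cop_delta (c : cop C) : cop C ⊗ cop C := tswap (delta (c : C)).

Fact cop_delta_linear : linear cop_delta.
Proof. exact: (linear_comp (@tswap_linear k C C) (@delta_linear k C)). Qed.
HB.instance Definition _ := GRing.isLinear.Build k (cop C) _ _ cop_delta cop_delta_linear.

Definition cop_counit (c : cop C) : k := counit (c : C).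
Fact cop_counit_linear : scalar cop_counit.
Proof. exact: counit_linear. Qed.
HB.instance Definition _ :=
  GRing.isLinear.Build k (cop C) _ _ cop_counit cop_counit_linear.

Let rev3 (t : C ⊗ (C ⊗ C)) : C ⊗ (C ⊗ C) := tassoc (tswap (tmap idfun tswap t)).

Let rev3E u v w : rev3 (u ⊗ (v ⊗ w)) = w ⊗ (v ⊗ u).
Proof. by rewrite /rev3 tmapE ?tswapE ?tassocE //; apply: tswap_linear. Qed.

Let rev3_linear : linear rev3.
Proof. by rewrite /rev3; lin. Qed.

Let cop_rev3l (t : C ⊗ C) :
  tmap idfun cop_delta (tswap t) = rev3 (tassoc (tmap delta idfun t)).
Proof.
move: t; apply: tensor_ext => [||u v]; try by move=> a x y; lin_rew; rewrite ?rev3_linear.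
rewrite tswapE !tmapE //; try exact: delta_linear; try exact: cop_delta_linear.
rewrite /cop_delta /=; move: (delta u); apply: tensor_ext.
- by move=> a x y; lin_rew; rewrite ?rev3_linear.
- by move=> a x y; lin_rew; rewrite ?rev3_linear.
- by move=> x y; rewrite tswapE tassocE rev3E.
Qed.

Let cop_rev3r (t : C ⊗ C) :
  tassoc (tmap cop_delta idfun (tswap t)) = rev3 (tmap idfun delta t).
Proof.
move: t; apply: tensor_ext => [||u v]; try by move=> a x y; lin_rew; rewrite ?rev3_linear.
rewrite tswapE !tmapE //; try exact: delta_linear; try exact: cop_delta_linear.
rewrite /cop_delta /=; move: (delta v); apply: tensor_ext.
- by move=> a x y; lin_rew; rewrite ?rev3_linear.
- by move=> a x y; lin_rew; rewrite ?rev3_linear.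
- by move=> x y; rewrite tswapE tassocE rev3E.
Qed.

Fact cop_coassoc (c : cop C) :
  tassoc (tmap cop_delta idfun (cop_delta c)) = tmap idfun cop_delta (cop_delta c).
Proof. by rewrite [LHS]cop_rev3r [RHS]cop_rev3l delta_coassoc. Qed.

Let tlift_swap (W : lmodType k) (f : C -> C -> W) (t : C ⊗ C) :
  is_bilinear f -> tlift f (tswap t) = tlift (fun u v => f v u) t.
Proof.
move=> fbil; have fbil' : is_bilinear (fun u v => f v u) by case: fbil.
move: t; apply: tensor_ext => [a x y|a x y|u v].
- by rewrite tswap_linear tlift_linear.
- by rewrite tlift_linear.
- by rewrite tswapE !tliftE.
Qed.

Fact cop_counitl (c : cop C) :
  tlift (fun c1 c2 : cop C => cop_counit c1 *: c2) (cop_delta c) = c.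
Proof.
exact: etrans (tlift_swap _ (scale_bilinearl C)) (delta_counitr (c : C)).
Qed.

Fact cop_counitr (c : cop C) :
  tlift (fun c1 c2 : cop C => cop_counit c2 *: c1) (cop_delta c) = c.
Proof.
exact: etrans (tlift_swap _ (scale_bilinearr C)) (delta_counitl (c : C)).
Qed.


HB.instance Definition _ :=
  isCoalgebra.Build k (cop C) cop_coassoc cop_counitl cop_counitr.

End Coopposite.

Section TensorCoalgebra.
Variables (k : fieldType) (C D : coalgType k).

Definition tensor_delta (t : C ⊗ D) : (C ⊗ D) ⊗ (C ⊗ D) :=
  tinter (tmap delta delta t).
Fact tensor_delta_linear : linear tensor_delta.
Proof. by rewrite /tensor_delta; lin. Qed.
HB.instance Definition _ :=
  GRing.isLinear.Build k _ _ _ tensor_delta tensor_delta_linear.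

Definition tensor_counit (t : C ⊗ D) : k :=
  @tlift k C D k^o (fun c d => counit c * counit d) t.
Fact tensor_counit_bilinear :
  @is_bilinear k C D k^o (fun c d => counit c * counit d).
Proof.
split=> [d|c] a x y; rewrite counit_linear ?mulrDl ?mulrDr -?mulrA //.
by rewrite mulrCA.
Qed.
Fact tensor_counit_linear : scalar tensor_counit.
Proof. exact: (tlift_linear tensor_counit_bilinear). Qed.
HB.instance Definition _ :=
  GRing.isLinear.Build k _ _ _ tensor_counit tensor_counit_linear.

Lemma tensor_counitE (c : C) (d : D) :
  tensor_counit (c ⊗ d) = counit c * counit d.
Proof. exact: (tliftE tensor_counit_bilinear). Qed.

Lemma tensor_deltaE (c : C) (d : D) :
  tensor_delta (c ⊗ d) = tinter (delta c ⊗ delta d).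
Proof. by rewrite /tensor_delta tmapE //; apply: delta_linear. Qed.

Let inter3 (s : (C ⊗ (C ⊗ C)) ⊗ (D ⊗ (D ⊗ D))) := tmap idfun tinter (tinter s).

Let inter3E c c' c'' d d' d'' :
  inter3 ((c ⊗ (c' ⊗ c'')) ⊗ (d ⊗ (d' ⊗ d''))) =
  (c ⊗ d) ⊗ ((c' ⊗ d') ⊗ (c'' ⊗ d'')).
Proof.
by rewrite /inter3 tinterE tmapE ?tinterE //; apply: tinter_linear.
Qed.

Let inter3_linear : linear inter3.
Proof. by rewrite /inter3; lin. Qed.

Let tensor_ext2 (U U' V V' W : lmodType k)
    (F G : U ⊗ U' -> V ⊗ V' -> W) :
  is_bilinear F -> is_bilinear G ->
  (forall u u' v v', F (u ⊗ u') (v ⊗ v') = G (u ⊗ u') (v ⊗ v')) ->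
  forall s t, F s t = G s t.
Proof.
move=> [Fl Fr] [Gl Gr] FG s t; move: s; apply: tensor_ext => // u u'.
by move: t; apply: tensor_ext.
Qed.

Let inter3l (X : C ⊗ C) (Y : D ⊗ D) :
  tassoc (tmap tensor_delta idfun (tinter (X ⊗ Y))) =
  inter3 (tassoc (tmap delta idfun X) ⊗ tassoc (tmap delta idfun Y)).
Proof.
move: X Y; apply: tensor_ext2 => [||c c' d d'].
- by split=> [?|?] ? ? ?;
    rewrite ?tensl_linear ?tensr_linear tinter_linear tmapP tassoc_linear.
- by split=> [?|?] ? ? ?;
    rewrite tmapP tassoc_linear ?tensl_linear ?tensr_linear inter3_linear.
rewrite tinterE !tmapE //; try exact: delta_linear; try exact: tensor_delta_linear.
rewrite tensor_deltaE /=; move: (delta c) (delta d).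
apply: tensor_ext2 => [||x x' y y'].
- by split=> [?|?] ? ? ?; rewrite ?tensl_linear ?tensr_linear tinter_linear
    ?tensl_linear ?tensr_linear tassoc_linear.
- by split=> [?|?] ? ? ?; rewrite ?tensl_linear ?tensr_linear tassoc_linear
    ?tensl_linear ?tensr_linear inter3_linear.
by rewrite tinterE !tassocE inter3E.
Qed.

Let inter3r (X : C ⊗ C) (Y : D ⊗ D) :
  tmap idfun tensor_delta (tinter (X ⊗ Y)) =
  inter3 (tmap idfun delta X ⊗ tmap idfun delta Y).
Proof.
move: X Y; apply: tensor_ext2 => [||c c' d d'].
- by split=> [?|?] ? ? ?;
    rewrite ?tensl_linear ?tensr_linear tinter_linear tmapP.
- by split=> [?|?] ? ? ?;
    rewrite tmapP ?tensl_linear ?tensr_linear inter3_linear.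
rewrite tinterE !tmapE //; try exact: delta_linear; try exact: tensor_delta_linear.
rewrite tensor_deltaE /=; move: (delta c') (delta d').
apply: tensor_ext2 => [||x x' y y'].
- by split=> [?|?] ? ? ?; rewrite ?tensl_linear ?tensr_linear tinter_linear
    ?tensr_linear.
- by split=> [?|?] ? ? ?; rewrite ?tensl_linear ?tensr_linear ?tensl_linear
    inter3_linear.
by rewrite tinterE inter3E.
Qed.

Fact tensor_coassoc (t : C ⊗ D) :
  tassoc (tmap tensor_delta idfun (tensor_delta t)) =
  tmap idfun tensor_delta (tensor_delta t).
Proof.
move: t; apply: tensor_ext;
  try by move=> a x y; rewrite tensor_delta_linear; lin_rew.
by move=> c d; rewrite tensor_deltaE inter3l inter3r !delta_coassoc.
Qed.

Let scalel_bilinear :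
  is_bilinear (fun t1 t2 : C ⊗ D => tensor_counit t1 *: t2).
Proof.
split=> [v|u] a x y; first by rewrite tensor_counit_linear scalerDl scalerA.
by rewrite scalerDr !scalerA mulrC.
Qed.
Let scaler_bilinear :
  is_bilinear (fun t1 t2 : C ⊗ D => tensor_counit t2 *: t1).
Proof.
split=> [v|u] a x y; last by rewrite tensor_counit_linear scalerDl scalerA.
by rewrite scalerDr !scalerA mulrC.
Qed.

Fact tensor_counitl (t : C ⊗ D) :
  tlift (fun t1 t2 => tensor_counit t1 *: t2) (tensor_delta t) = t.
Proof.
move: t; apply: tensor_ext => //.
  by apply: linear_comp; [apply: tlift_linear | exact: tensor_delta_linear].
move=> c d; rewrite tensor_deltaE -[in RHS](delta_counitl c) -[in RHS](delta_counitl d).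
move: (delta c) (delta d); apply: tensor_ext2.
- by split=> [?|?] ? ? ?;
    rewrite ?(tensl_linear, tensr_linear) tinter_linear (tlift_linear scalel_bilinear).
- by split=> [?|?] ? ? ?;
    rewrite (tlift_linear (scale_bilinearl _)) ?(tensl_linear, tensr_linear).
move=> c1 c2 d1 d2; rewrite tinterE !tliftE //; try exact: scale_bilinearl.
by rewrite tensor_counitE tensZl tensZr scalerA.
Qed.
Fact tensor_counitr (t : C ⊗ D) :
  tlift (fun t1 t2 => tensor_counit t2 *: t1) (tensor_delta t) = t.
Proof.
move: t; apply: tensor_ext => //.
  by apply: linear_comp; [apply: tlift_linear | exact: tensor_delta_linear].
move=> c d; rewrite tensor_deltaE -[in RHS](delta_counitr c) -[in RHS](delta_counitr d).
move: (delta c) (delta d); apply: tensor_ext2.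
- by split=> [?|?] ? ? ?;
    rewrite ?(tensl_linear, tensr_linear) tinter_linear (tlift_linear scaler_bilinear).
- by split=> [?|?] ? ? ?;
    rewrite (tlift_linear (scale_bilinearr _)) ?(tensl_linear, tensr_linear).
move=> c1 c2 d1 d2; rewrite tinterE !tliftE //; try exact: scale_bilinearr.
by rewrite tensor_counitE tensZl tensZr scalerA.
Qed.

HB.instance Definition _ := isCoalgebra.Build k (C ⊗ D)%type
  tensor_coassoc tensor_counitl tensor_counitr.

End TensorCoalgebra.

HB.mixin Record isHopfHeap (k : fieldType) H of Coalgebra k H := {
  bracket_map : (H ⊗ cop H ⊗ H)%type -> H;
  bracket_coalgebra_map : coalgebra_map bracket_map;
  bracketA : forall a b c d h : H,
    bracket_map (bracket_map (a ⊗ (b : cop H) ⊗ c) ⊗ (d : cop H) ⊗ h) =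
    bracket_map (a ⊗ (b : cop H) ⊗ bracket_map (c ⊗ (d : cop H) ⊗ h));
  bracket_counitl : forall c a : H,
    sweedler2 (fun c1 c2 : H => bracket_map (c1 ⊗ (c2 : cop H) ⊗ a)) c =
    counit c *: a;
  bracket_counitr : forall c a : H,
    sweedler2 (fun c1 c2 : H => bracket_map (a ⊗ (c1 : cop H) ⊗ c2)) c =
    counit c *: a
}.

#[short(type="hopfHeapType")]
HB.structure Definition HopfHeap (k : fieldType) :=
  {H of isHopfHeap k H & Coalgebra k H}.

Definition bracket (k : fieldType) (H : hopfHeapType k) (a b c : H) : H :=
  bracket_map (a ⊗ (b : cop H) ⊗ c).

Lemma delta_bracket (k : fieldType) (H : hopfHeapType k) (a b c : H) :
  delta (bracket a b c) =
  tmap (@bracket_map k H) (@bracket_map k H)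
    (tinter (tinter (delta a ⊗ (tswap (delta b) : cop H ⊗ cop H)) ⊗ delta c)).
Proof.
have [_ h _] := @bracket_coalgebra_map k H.
rewrite /bracket h; congr (tmap _ _ _).
by rewrite [LHS]tensor_deltaE [X in X ⊗ _]tensor_deltaE.
Qed.

Definition nonunital_bialgebra (k : fieldType) (H : coalgType k)
    (mul : H -> H -> H) : Prop :=
  [/\ is_bilinear mul, associative mul
    & coalgebra_map (tlift mul : (H ⊗ H)%type -> H)].

Definition hopf_truss (k : fieldType) (H : hopfHeapType k)
    (mul : H -> H -> H) : Prop :=
  nonunital_bialgebra mul /\
  forall a b c d : H,
    mul a (bracket b c d) =
    sweedler3 (fun a1 a2 a3 => bracket (mul a1 b) (mul a2 c) (mul a3 d)) a.

(* Main.v *)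
Require Import Defs.
From mathcomp Require Import all_boot all_algebra.
From mathcomp Require Import boolp ring.
Import GRing.Theory.
Local Open Scope ring_scope.

(** The map [c |-> ε(c) x] from any coalgebra is a coalgebra map because [x] is
    group-like; applied to the coalgebra [H ⊗ H] it is the multiplication [·_x].
    Both sides of the truss law are multiples of [x] and [[x, x, x]], the scalars
    agree by counitality, and [[x, x, x] = ε(x) x = x]. *)

Lemma counit_scale_linear (k : fieldType) (C : coalgType k) (W : lmodType k)
  (w : W) : linear (fun c : C => counit c *: w).
Proof. by move=> a u v; rewrite counit_linear scalerDl scalerA. Qed.

Lemma counit_mul_bilinear (k : fieldType) (C D : coalgType k) (W : lmodType k)
    (w : W) :
  is_bilinear (fun (c : C) (d : D) => (counit c * counit d) *: w).
Proof.
split=> [d|c] a u v; rewrite counit_linear.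
  by rewrite mulrDl scalerDl -mulrA scalerA.
by rewrite mulrDr scalerDl mulrCA scalerA.
Qed.

(** Applying [counit] to the axiom ε(c_1) c_2 = c gives ε(c_1) ε(c_2) = ε(c). Used from right to
    left, it splits a scalar ε(c) over Sweedler components. *)
Lemma sweedler2_counit (k : fieldType) (C : coalgType k) (W : lmodType k)
    (w : W) (c : C) :
  sweedler2 (fun c1 c2 => (counit c1 * counit c2) *: w) c = counit c *: w.
Proof.
(* Once both sides depend on [c] only through [delta c], it is generalized to an arbitrary tensor
   and the identity is checked on pure tensors. *)
rewrite /sweedler2 -[in RHS](delta_counitl c); move: (delta c).
apply: tensor_ext => [||u v].
- exact/tlift_linear/counit_mul_bilinear.
- apply: (linear_comp (@counit_scale_linear k C W w)).
  exact/tlift_linear/scale_bilinearl.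
- rewrite !tliftE; [|exact: scale_bilinearl|exact: counit_mul_bilinear].
  by rewrite linearZ.
Qed.

Lemma coalgebra_map_group_like (k : fieldType) (C D : coalgType k) (x : D) :
  group_like x -> coalgebra_map (fun c : C => counit c *: x).
Proof.
move=> [dx ex]; have fl := @counit_scale_linear k C D x.
split=> // c; last by rewrite linearZ /= ex mulr1.
(* Splitting the scalar in ε(c) (x ⊗ x) into ε(c_1) ε(c_2) gives ε(c_1) x ⊗ ε(c_2) x, the image of
   Δ(c). *)
rewrite linearZ /= dx -sweedler2_counit /sweedler2 /tmap.
congr tlift; apply/funext => u; apply/funext => v.
by rewrite tensZl tensZr scalerA.
Qed.

Lemma coalgebra_map_linear (k : fieldType) (C D : coalgType k) (f : C -> D) :
  coalgebra_map f -> linear f.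
Proof. by case. Qed.

Lemma coalgebra_map_counit (k : fieldType) (C D : coalgType k) (f : C -> D) :
  coalgebra_map f -> forall c, counit (f c) = counit c.
Proof. by case. Qed.

Lemma bracket_map_linear (k : fieldType) (H : hopfHeapType k) :
  linear (@bracket_map k H).
Proof. exact: (coalgebra_map_linear _ _ _ _ (@bracket_coalgebra_map k H)). Qed.

Lemma bracket_linear1 (k : fieldType) (H : hopfHeapType k) (b c : H) :
  linear (fun a : H => bracket a b c).
Proof.
exact: (linear_comp (@bracket_map_linear k H)
  (linear_comp (tensl_linear c) (tensl_linear (b : cop H)))).
Qed.

Lemma bracket_linear2 (k : fieldType) (H : hopfHeapType k) (a c : H) :
  linear (fun b : H => bracket a b c).
Proof.
exact: (linear_comp (@bracket_map_linear k H)
  (linear_comp (tensl_linear c) (@tensr_linear k H (cop H) a))).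
Qed.

Lemma bracket_linear3 (k : fieldType) (H : hopfHeapType k) (a b : H) :
  linear (fun c : H => bracket a b c).
Proof.
exact: (linear_comp (@bracket_map_linear k H)
  (tensr_linear (a ⊗ (b : cop H)))).
Qed.

Lemma bracketZ (k : fieldType) (H : hopfHeapType k) (r s t : k) (a b c : H) :
  bracket (r *: a) (s *: b) (t *: c) = (r * s * t) *: bracket a b c.
Proof.
rewrite (scalable_linear (bracket_linear1 k H (s *: b) (t *: c))).
rewrite (scalable_linear (bracket_linear2 k H a (t *: c))).
by rewrite (scalable_linear (bracket_linear3 k H a b)) /= 2!scalerA.
Qed.

(** [cop H] reverses the comultiplication but keeps the counit, so the middle argument contributes
    [counit b] like the others. *)
Lemma counit_bracket (k : fieldType) (H : hopfHeapType k) (a b c : H) :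
  counit (bracket a b c) = counit a * counit b * counit c.
Proof.
rewrite /bracket (coalgebra_map_counit _ _ _ _ (@bracket_coalgebra_map k H)).
by rewrite [LHS]tensor_counitE; congr (_ * _); exact: tensor_counitE.
Qed.

(** As Δ(x) = x ⊗ x and ε(x) = 1, this is the axiom [bracket_counitl] at [x]. *)
Lemma bracket_group_like (k : fieldType) (H : hopfHeapType k) (x a : H) :
  group_like x -> bracket x x a = a.
Proof.
move=> [dx ex]; have := bracket_counitl x a.
rewrite ex scale1r /sweedler2 dx tliftE //.
by split=> [c|c]; [apply: bracket_linear1 | apply: bracket_linear2].
Qed.

Theorem lemma3p8 (k : fieldType) (H : hopfHeapType k) (x : H) (hx : group_like x) :
  hopf_truss (fun a b : H => (counit a * counit b) *: x).
Proof.
have [_ ex] := hx.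
have mul_bilin := @counit_mul_bilinear k H H H x.
split=> [|a b c d].
  (* Associativity: both triple products are ε(a) ε(b) ε(c) x because ε(x) = 1. *)
  split=> // [a b c|]; first by rewrite !linearZ /= ex !mulr1 mulrA.
  suff -> : tlift (fun a b : H => (counit a * counit b) *: x) =
            (fun t : (H ⊗ H)%type => counit t *: x).
    exact: coalgebra_map_group_like.
  apply/funext; apply: tensor_ext => [||u v].
  - exact: tlift_linear.
  - exact: counit_scale_linear.
  - by rewrite tliftE //; congr (_ *: _); rewrite -tensor_counitE.
set K := counit b * counit c * counit d.
(* The factor ε(a) is split twice, following the nesting of [sweedler3], so that the two sides can
   be compared for arbitrary [c1], [c2], [c3]. *)
rewrite counit_bracket -/K -scalerA -sweedler2_counit /sweedler3.
congr sweedler2; apply/funext => c'; apply/funext => c3.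
rewrite -scalerA -sweedler2_counit.
congr sweedler2; apply/funext => c1; apply/funext => c2.
rewrite bracketZ bracket_group_like // !scalerA; congr (_ *: _).
by rewrite /K; ring.
Qed.
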